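(* Assume the ABC Conjecture over $\mathbb{Z}$. There is an absolute constant $c>0$ such that the following holds. Let $N>0$ be an integer and let $E_N$ be the elliptic curve $y^2=x^3-Nx$ over $\mathbb{Q}$. Let $Q_1\in E_N(\mathbb{Q})$ be a non-torsion point with $x(Q_1)<0$. (1) For every nonzero integer $n$ with $L(nQ_1)\le 1$, we have $h_O(nQ_1)\le c\log N$. (2) Let $Q_2\in E_N(\mathbb{Q})$ be such that $Q_1,Q_2$ are linearly independent (no relation $aQ_1+bQ_2=O$ with integers $(a,b)\ne(0,0)$). Assume moreover that either $Q_2=2R$ for some $R\in E_N(\mathbb{Q})$, or $x(Q_2)$ is the square of a rational number. Let $G=\langle Q_1,Q_2\rangle=\{n_1Q_1+n_2Q_2: n_1,n_2\in\mathbb{Z}\}$. Then for every $Q\in G$ with $Q\neq O$ and $L(Q)\le 1$ we have $h_O(Q)\le c\log N$.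
   Context: ABC Conjecture over $\mathbb{Z}$: for every $\epsilon>0$ there is a constant $K_\epsilon$ such that for all coprime integers $a,b,c$ with $a+b=c$ one has $\max(|a|,|b|,|c|)\le K_\epsilon\,\mathrm{rad}(abc)^{1+\epsilon}$, where $\mathrm{rad}(m)$ is the product of the distinct primes dividing $m$. The constant $c$ may depend on the constants $K_\epsilon$ of the ABC Conjecture, but not on $N$, the points, or the integers $n,n_1,n_2$. $O$ denotes the point at infinity. For a rational point $Q\ne O$, $h_O(Q)=\max\{0,\log|x(Q)|\}$. For a rational point $Q\ne O$ on an elliptic curve in Weierstrass form over $\mathbb{Q}$, the length $L(Q)$ is the number of distinct primes $p$ with $|x(Q)|_p>1$, where $|\cdot|_p$ is the usual $p$-adic absolute value. Equivalently, write $x(Q)=A_Q/B_Q^2$ in lowest terms; then $L(Q)$ is the number of distinct prime divisors of $B_Q$. *)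

(* Defs.v *)
From HB Require Import structures.
From mathcomp Require Import all_boot all_order all_algebra.
From Stdlib Require Import Reals.
Set Implicit Arguments. Unset Strict Implicit. Unset Printing Implicit Defensive.
Import Order.TTheory GRing.Theory Num.Theory.

Section Curve.
Local Open Scope ring_scope.

(* None = point at infinity O *)
Definition point := option (rat * rat).

Definition on_curve (N : nat) (P : point) : bool :=
  match P with
  | None => true
  | Some (x, y) => y ^+ 2 == x ^+ 3 - (N%:R) * x
  end.

Definition ec_neg (P : point) : point :=
  match P with None => None | Some (x, y) => Some (x, - y) end.

Definition ec_add (N : nat) (P Q : point) : point :=
  match P, Q with
  | None, _ => Q
  | _, None => P
  | Some (x1, y1), Some (x2, y2) =>
      if x1 == x2 then
        if y1 == - y2 then None
        else let l := (3%:R * x1 ^+ 2 - N%:R) / (2%:R * y1) in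
             let x3 := l ^+ 2 - x1 - x2 in
             Some (x3, l * (x1 - x3) - y1)
      else let l := (y2 - y1) / (x2 - x1) in
           let x3 := l ^+ 2 - x1 - x2 in
           Some (x3, l * (x1 - x3) - y1)
  end.

Fixpoint ec_muln (N : nat) (n : nat) (P : point) : point :=
  match n with
  | 0%N => None
  | n'.+1 => ec_add N P (ec_muln N n' P)
  end.

Definition ec_mul (N : nat) (n : int) (P : point) : point :=
  match n with
  | Posz k => ec_muln N k P
  | Negz k => ec_neg (ec_muln N k.+1 P)
  end.

Definition x_neg (P : point) : bool :=
  match P with None => false | Some (x, _) => x < 0 end.

Definition x_is_square (P : point) : Prop :=
  match P with None => False | Some (x, _) => exists r : rat, x = r ^+ 2 end.

(* length L(P): number of distinct primes dividing the denominator of x(P)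
   (x = A/B^2 in lowest terms, denq x = B^2 has the same prime divisors as B);
   L(O) := 0 by convention (never used). *)
Definition length_L (P : point) : nat :=
  match P with None => 0%N | Some (x, _) => size (primes (absz (denq x))) end.

End Curve.

Definition int_to_R (z : int) : R :=
  match z with
  | Posz n => INR n
  | Negz n => Ropp (INR n.+1)
  end.

Definition rat_to_R (q : rat) : R := Rdiv (int_to_R (numq q)) (int_to_R (denq q)).

(* h_O(Q) = max{0, log |x(Q)|}; h_O(O) := 0 (never used) *)
Definition h_O (P : point) : R :=
  match P with
  | None => 0%R
  | Some (x, _) => Rmax 0 (ln (Rabs (rat_to_R x)))
  end.

(* radical of a natural number: product of distinct prime divisors (rad 0 = 1) *)
Definition rad (n : nat) : nat := \prod_(p <- primes n) p.

Definition ABC_conjecture : Prop :=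
  forall eps : R, (0 < eps)%R ->
  exists K : R,
    forall a b c : int,
      coprimez a b -> coprimez b c -> coprimez a c ->
      @eq int (GRing.add a b) c ->
      (INR (maxn (absz a) (maxn (absz b) (absz c))) <=
         K * Rpower (INR (rad (absz (GRing.mul (GRing.mul a b) c)))) (1 + eps))%R.

(* Main.v *)
Require Import Defs.
From Stdlib Require Import Reals Lra.
From HB Require Import structures.
From mathcomp Require Import all_boot all_order all_algebra.
From mathcomp Require Import zify ring.
Import Order.TTheory GRing.Theory Num.Theory.
Set Implicit Arguments.
Unset Strict Implicit.
Unset Printing Implicit Defensive.

Delimit Scope ring_scope with ring.
Delimit Scope R_scope with R.

(** The map [P |-> x(P)] modulo nonzero squares, with [O |-> 1] and
    [(0, 0) |-> -N], is a homomorphism. Since the class of [Q2] is trivial, that of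
    [Q = n1 Q1 + n2 Q2] is negative for odd [n1], whence [|x(Q)| <= N], and trivial
    for even [n1]. In the latter case [x(Q)] is a square [(a / B)^2], and the
    equation of the curve becomes [(a^2 - b) (a^2 + b) = N B^4]. When [B] is a prime
    power, it is nearly coprime to one of the two factors, so that
    [u B^4 + 2 v = 4 a^2] with [u v = 2 N]. As [B] is [O(a^(1/2))], the radical of
    this sum is [O(N a^(3/2))], and ABC bounds [a] by a power of [N]. For [N = 1]
    the bound [c log N] vanishes, and Fermat's theorem on [a^4 - B^4 = b^2] is
    needed instead. *)

Section SquareClasses.
Local Open Scope ring_scope.
Variable F : fieldType.
Implicit Types a b c p q s : F.

Definition eq_mod_sqr p q : Prop := exists2 r : F, r != 0 & p = r ^+ 2 * q.

Lemma eq_mod_sqr_refl p : eq_mod_sqr p p.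
Proof. by exists 1; rewrite ?oner_neq0 // expr1n mul1r. Qed.

Lemma eq_mod_sqr_sym p q : eq_mod_sqr p q -> eq_mod_sqr q p.
Proof.
move=> [r r_neq0 ->]; exists r^-1; rewrite ?invr_neq0 //.
by rewrite mulrA -exprMn mulVf // expr1n mul1r.
Qed.

Lemma eq_mod_sqr_trans q p s : eq_mod_sqr p q -> eq_mod_sqr q s -> eq_mod_sqr p s.
Proof.
by move=> [r r_neq0 ->] [t t_neq0 ->]; exists (r * t); rewrite ?mulf_neq0 // exprMn mulrA.
Qed.

Lemma eq_mod_sqrM p q a b :
  eq_mod_sqr p q -> eq_mod_sqr a b -> eq_mod_sqr (p * a) (q * b).
Proof.
move=> [r r_neq0 ->] [t t_neq0 ->]; exists (r * t); rewrite ?mulf_neq0 //.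
by rewrite exprMn mulrACA.
Qed.

Lemma eq_mod_sqrX p q n : eq_mod_sqr p q -> eq_mod_sqr (p ^+ n) (q ^+ n).
Proof.
move=> [r r_neq0 ->]; exists (r ^+ n); rewrite ?expf_neq0 //.
by rewrite exprMn exprAC.
Qed.

Lemma eq_mod_sqr_sqr p : p != 0 -> eq_mod_sqr (p ^+ 2) 1.
Proof. by exists p; rewrite ?mulr1. Qed.

Lemma eq_mod_sqr_of_prod a b c s :
  s != 0 -> a * b * c = s ^+ 2 -> eq_mod_sqr c (a * b).
Proof.
move=> s_neq0 abc_sqr; have ab_neq0 : a * b != 0.
  by apply: contraNneq s_neq0 => ab_eq0; rewrite -sqrf_eq0 -abc_sqr ab_eq0 mul0r.
exists (s / (a * b)); first by rewrite mulf_neq0 ?invr_neq0.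
by rewrite expr_div_n -abc_sqr; move: (a * b) ab_neq0 => d d_neq0; field.
Qed.

(* On [y^2 = x (x^2 - n)], the abscissa [0] inherits the class of [x^2 - n]. *)
Definition x_class (n x : F) : F := if x == 0 then - n else x.

Lemma x_class_neq0 n x : n != 0 -> x_class n x != 0.
Proof. by rewrite /x_class; case: ifPn => // _; rewrite oppr_eq0. Qed.

Lemma x_class_prod_eq0 n x1 x2 x3 : n != 0 ->
    x1 * x2 + x1 * x3 + x2 * x3 = - n -> x1 * x2 * x3 = 0 ->
  x_class n x1 * x_class n x2 * x_class n x3 = n ^+ 2.
Proof.
move=> n_neq0 sym2 sym3.
have class_of_zero a b : a * b = - n -> - n * x_class n a * x_class n b = n ^+ 2.
  move=> ab; have : a * b != 0 by rewrite ab oppr_eq0.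
  rewrite mulf_eq0 => /norP[a_neq0 b_neq0].
  by rewrite /x_class (negPf a_neq0) (negPf b_neq0) -mulrA ab mulrNN expr2.
have x_class0 : x_class n 0 = - n by rewrite /x_class eqxx.
move/eqP: sym3; rewrite !mulf_eq0 => /orP[/orP[]|] /eqP x_eq0;
  rewrite x_eq0 in sym2 *; rewrite x_class0.
- by apply: class_of_zero; rewrite -sym2; ring.
- by rewrite [x_class n x1 * _]mulrC; apply: class_of_zero; rewrite -sym2; ring.
- by rewrite mulrC mulrA; apply: class_of_zero; rewrite -sym2; ring.
Qed.

Lemma x_class_vieta n l m x1 x2 x3 : n != 0 ->
    x1 * x2 + x1 * x3 + x2 * x3 = - n - 2%:R * l * m ->
    x1 * x2 * x3 = m ^+ 2 ->
  eq_mod_sqr (x_class n x3) (x_class n x1 * x_class n x2).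
Proof.
move=> n_neq0 sym2 sym3; have [m_eq0|m_neq0] := eqVneq m 0.
  move: sym2 sym3; rewrite m_eq0 mulr0 subr0 expr0n /= => sym2 sym3.
  exact: eq_mod_sqr_of_prod n_neq0 (x_class_prod_eq0 n_neq0 sym2 sym3).
have : x1 * x2 * x3 != 0 by rewrite sym3 sqrf_eq0.
rewrite !mulf_eq0 => /norP[/norP[/negPf x1_neq0 /negPf x2_neq0] /negPf x3_neq0].
by apply: eq_mod_sqr_of_prod m_neq0 _; rewrite /x_class x1_neq0 x2_neq0 x3_neq0.
Qed.

End SquareClasses.

Section NegativeOrSquare.
Local Open Scope ring_scope.
Variable F : realFieldType.
Implicit Types p q : F.

Definition negative_or_square q : Prop := q < 0 \/ eq_mod_sqr q 1.

Lemma negative_or_square_eq_mod_sqr p q :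
  eq_mod_sqr p q -> negative_or_square q -> negative_or_square p.
Proof.
move=> pq [q_lt0|q_sqr]; last by right; apply: eq_mod_sqr_trans q_sqr.
by left; case: pq => r r_neq0 ->; rewrite pmulr_rlt0 ?exprn_even_gt0.
Qed.

Lemma negative_or_squareX q n : q < 0 -> negative_or_square (q ^+ n).
Proof.
move=> q_lt0; have [odd_n|even_n] := boolP (odd n); first by left; rewrite exprn_odd_lt0.
right; rewrite -(even_halfK even_n) -muln2 exprM.
by apply/eq_mod_sqr_sqr/expf_neq0; rewrite lt_eqF.
Qed.

End NegativeOrSquare.

Section CurveGroup.
Local Open Scope ring_scope.
Variable N : nat.
Implicit Types (P Q : point) (x y : rat).

(* Vieta's formulas for [X^3 - l^2 X^2 - (N + 2 l m) X - m^2], whose roots are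
   the abscissae of the intersection of the curve with [Y = l X + m]. *)
Lemma ec_add_vieta x1 y1 x2 y2 x3 y3 :
    on_curve N (Some (x1, y1)) -> on_curve N (Some (x2, y2)) ->
    ec_add N (Some (x1, y1)) (Some (x2, y2)) = Some (x3, y3) ->
  exists l m : rat,
    [/\ x1 + x2 + x3 = l ^+ 2,
        x1 * x2 + x1 * x3 + x2 * x3 = - N%:R - 2%:R * l * m,
        x1 * x2 * x3 = m ^+ 2 & y3 = - (l * x3 + m)].
Proof.
rewrite /on_curve => /eqP on1 /eqP on2 add3.
suff [l [N_eq -> ->]] : exists l : rat,
    [/\ N%:R = x1 ^+ 2 + x1 * x2 + x2 ^+ 2 - l * (2%:R * y1 + l * (x2 - x1)),
        x3 = l ^+ 2 - x1 - x2 & y3 = l * (x1 - x3) - y1].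
  rewrite N_eq in on1.
  exists l, (y1 - l * x1); rewrite {}N_eq; split; try ring.
  by rewrite sqrrB on1; ring.
move: add3 => /=; have [eq_x|neq_x] := eqVneq x1 x2.
  subst x2; case: ifPn => // neq_y [] <- <-.
  have eq_y : y1 = y2.
    apply/eqP; move/eqP: (etrans on1 (esym on2)).
    by rewrite eqf_sqr (negPf neq_y) orbF.
  subst y2; have y1_neq0 : y1 != 0.
    by apply: contraNneq neq_y => ->; rewrite oppr0.
  by eexists; split; [|reflexivity..]; field.
case=> <- <-; have dx_neq0 : x2 - x1 != 0 by rewrite subr_eq0 eq_sym.
eexists; split; [|reflexivity..]; apply: (mulfI dx_neq0).
have -> : (x2 - x1) * N%:R = x2 ^+ 3 - x1 ^+ 3 - (y2 ^+ 2 - y1 ^+ 2).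
  by rewrite on1 on2; ring.
by field.
Qed.

Lemma on_curve_add P Q : on_curve N P -> on_curve N Q -> on_curve N (ec_add N P Q).
Proof.
case: P Q => [[x1 y1]|] [[x2 y2]|] // on1 on2.
case add3: (ec_add N _ _) => [[x3 y3]|] //.
have [l [m [sym1 sym2 sym3 ->]]] := ec_add_vieta on1 on2 add3.
have -> /= : on_curve N (Some (x3, - (l * x3 + m)))
    = ((l * x3 + m) ^+ 2 == x3 ^+ 3 - N%:R * x3) by rewrite /= sqrrN.
have -> : N%:R = - (x1 * x2 + x1 * x3 + x2 * x3) - 2%:R * l * m by rewrite sym2; ring.
by rewrite sqrrD -sym3 exprMn -sym1; apply/eqP; ring.
Qed.

Lemma on_curve_neg P : on_curve N (ec_neg P) = on_curve N P.
Proof. by case: P => [[x y]|] //=; rewrite sqrrN. Qed.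

Lemma on_curve_muln k P : on_curve N P -> on_curve N (ec_muln N k P).
Proof. by move=> onP; elim: k => //= k; apply: on_curve_add. Qed.

Lemma on_curve_mul n P : on_curve N P -> on_curve N (ec_mul N n P).
Proof. by case: n => k onP; rewrite /ec_mul ?on_curve_neg; apply: on_curve_muln. Qed.

Lemma ec_mul2_x0 y : on_curve N (Some (0, y)) -> ec_mul N 2%:Z (Some (0, y)) = None.
Proof.
rewrite /= mulr0 expr0n subr0 sqrf_eq0 => /eqP->.
by rewrite !(oppr0, eqxx).
Qed.

Definition point_class P : rat := if P is Some (x, _) then x_class N%:R x else 1.

Hypothesis N_gt0 : (0 < N)%N.

Let N_neq0 : N%:R != 0 :> rat. Proof. by rewrite pnatr_eq0 -lt0n. Qed.

Lemma point_class_neq0 P : point_class P != 0.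
Proof. by case: P => [[x y]|] //=; apply: x_class_neq0. Qed.

Lemma x_le0_of_point_class_lt0 x y : point_class (Some (x, y)) < 0 -> x <= 0.
Proof. by rewrite /= /x_class; case: eqVneq => [->|_ /ltW]. Qed.

Lemma x_sqr_of_point_class_sqr x y : eq_mod_sqr (point_class (Some (x, y))) 1 ->
  exists2 r : rat, r != 0 & x = r ^+ 2.
Proof.
rewrite /= /x_class => -[r r_neq0]; rewrite mulr1.
case: eqVneq => [_ sqrN|_]; last by exists r.
by have := sqr_ge0 r; rewrite -sqrN oppr_ge0 lern0 -leqn0 leqNgt N_gt0.
Qed.

Lemma point_class_neg P : point_class (ec_neg P) = point_class P.
Proof. by case: P => [[x y]|]. Qed.

Lemma point_class_add P Q : on_curve N P -> on_curve N Q ->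
  eq_mod_sqr (point_class (ec_add N P Q)) (point_class P * point_class Q).
Proof.
case: P Q => [[x1 y1]|] [[x2 y2]|] on1 on2;
  rewrite ?mul1r ?mulr1; try exact: eq_mod_sqr_refl.
case add3: (ec_add N _ _) => [[x3 y3]|].
  have [l [m [_ sym2 sym3 _]]] := ec_add_vieta on1 on2 add3.
  exact: x_class_vieta sym2 sym3.
move: add3 => /=; case: eqVneq => // -> _; rewrite -expr2.
by apply/eq_mod_sqr_sym/eq_mod_sqr_sqr/x_class_neq0.
Qed.

Lemma point_class_muln k P : on_curve N P ->
  eq_mod_sqr (point_class (ec_muln N k P)) (point_class P ^+ k).
Proof.
move=> onP; elim: k => [|k IHk]; first exact: eq_mod_sqr_refl.
rewrite exprS; apply: eq_mod_sqr_trans (point_class_add onP (on_curve_muln k onP)) _.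
exact: eq_mod_sqrM (eq_mod_sqr_refl _) IHk.
Qed.

Lemma point_class_mul n P : on_curve N P ->
  eq_mod_sqr (point_class (ec_mul N n P)) (point_class P ^+ `|n|).
Proof.
by case: n => k onP; rewrite /ec_mul ?point_class_neg; apply: point_class_muln.
Qed.

Lemma point_class_double P : on_curve N P -> eq_mod_sqr (point_class (ec_add N P P)) 1.
Proof.
move=> onP; apply: eq_mod_sqr_trans (point_class_add onP onP) _.
by rewrite -expr2; apply/eq_mod_sqr_sqr/point_class_neq0.
Qed.

Lemma point_class_x_square P : on_curve N P -> ec_mul N 2%:Z P <> None ->
  x_is_square P -> eq_mod_sqr (point_class P) 1.
Proof.
case: P => [[x y]|] //; have [->|x_neq0] := eqVneq x 0; first by move=> /ec_mul2_x0->.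
move=> _ _ [r x_eq]; rewrite /= /x_class (negPf x_neq0) x_eq; apply: eq_mod_sqr_sqr.
by apply: contraNneq x_neq0 => r_eq0; rewrite x_eq r_eq0 expr0n.
Qed.

Lemma point_class_lincomb n1 n2 P Q : on_curve N P -> on_curve N Q ->
    eq_mod_sqr (point_class Q) 1 ->
  eq_mod_sqr (point_class (ec_add N (ec_mul N n1 P) (ec_mul N n2 Q)))
             (point_class P ^+ `|n1|).
Proof.
move=> onP onQ classQ.
apply: eq_mod_sqr_trans (point_class_add (on_curve_mul n1 onP) (on_curve_mul n2 onQ)) _.
rewrite -[X in eq_mod_sqr _ X]mulr1; apply: eq_mod_sqrM (point_class_mul n1 onP) _.
apply: eq_mod_sqr_trans (point_class_mul n2 onQ) _.
by rewrite -[X in eq_mod_sqr _ X](expr1n _ `|n2|%N); apply: eq_mod_sqrX.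
Qed.

Lemma point_class_lt0 P : x_neg P -> point_class P < 0.
Proof. by case: P => [[x y]|] //= x_lt0; rewrite /x_class lt_eqF. Qed.

End CurveGroup.

Section Fermat.
Implicit Types a b c e k m n w x y z : nat.

Lemma coprime_mul_exp e m n k : coprime m n -> m * n = k ^ e ->
  (exists s, m = s ^ e) /\ (exists t, n = t ^ e).
Proof.
suff left_root m' n' : coprime m' n' -> m' * n' = k ^ e -> exists s, m' = s ^ e.
  move=> cmn mn; split; first exact: left_root mn.
  by apply: (left_root n m); rewrite 1?coprime_sym 1?mulnC.
move=> cmn mn; have [m0|m_gt0] := posnP m'.
  by exists 0; move: mn; rewrite m0; case: e => // e _; rewrite exp0n.
have [n0|n_gt0] := posnP n'.
  by exists 1; move: cmn; rewrite n0 exp1n /coprime gcdn0 => /eqP.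
exists k`_\pi(m'); rewrite -partnX -mn partnM // partn_pi //.
by rewrite part_p'nat ?muln1 // -coprime_pi'.
Qed.

Lemma sum_odd_sqr_neq a b c : odd a -> odd b -> a ^ 2 + b ^ 2 <> c ^ 2.
Proof.
move=> oa ob; rewrite -(odd_double_half a) -(odd_double_half b) oa ob.
by rewrite -(odd_double_half c); case: (odd c) => /=; nia.
Qed.

Lemma pythagorean_param a b c :
    coprime a b -> odd a -> ~~ odd b -> a ^ 2 + b ^ 2 = c ^ 2 ->
  exists m n, [/\ a + n ^ 2 = m ^ 2, b = 2 * (m * n), c = m ^ 2 + n ^ 2 & coprime m n].
Proof.
move=> cab oa eb abc.
have oc : odd c by have := congr1 odd abc; rewrite oddD !oddX /= oa (negPf eb).
have le_ac : a <= c by rewrite -leq_sqr -abc leq_addr.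
have [t c_eq] : exists t, c = a + 2 * t.
  exists (c - a)./2; have : ~~ odd (c - a) by rewrite oddB // oc oa.
  by move/even_halfK; lia.
have [w b_eq] : exists w, b = 2 * w by exists b./2; rewrite mul2n even_halfK.
have prod : (a + t) * t = w ^ 2 by move: abc; rewrite c_eq b_eq; nia.
have cop : coprime (a + t) t.
  have dvd_a : gcdn (a + t) t %| a.
    by rewrite -(dvdn_addl _ (dvdn_gcdr (a + t) t)) dvdn_gcdl.
  have dvd_w : gcdn (a + t) t ^ 2 %| w ^ 2.
    by rewrite -prod dvdn_mul ?dvdn_gcdl ?dvdn_gcdr.
  rewrite /coprime -dvdn1 -(eqP cab) dvdn_gcd dvd_a b_eq dvdn_mull //.
  by rewrite -(@dvdn_pexp2r _ _ 2).
have [[m m_eq] [n n_eq]] := coprime_mul_exp cop prod.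
exists m, n; split; [lia | | lia |].
  rewrite b_eq; congr muln; apply/eqP; rewrite -eqn_sqr; apply/eqP.
  by rewrite -prod m_eq n_eq expnMn.
by move: cop; rewrite m_eq n_eq coprime_pexpl ?coprime_pexpr.
Qed.

Definition quartic_triple x y z : Prop :=
  [/\ 0 < y, 0 < z & x ^ 4 = y ^ 4 + z ^ 2].

Definition smaller_quartic_triple x : Prop :=
  exists x' y' z', x' < x /\ quartic_triple x' y' z'.

Lemma quartic_triple_gt0 x y z : quartic_triple x y z -> 0 < x.
Proof.
by case=> y_gt0 _ xyz; rewrite -(ltn_exp2r _ _ (isT : 0 < 4)) xyz addn_gt0 expn_gt0 y_gt0.
Qed.

Lemma quartic_triple_noncoprime x y z :
  quartic_triple x y z -> ~~ coprime x y -> smaller_quartic_triple x.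
Proof.
move=> xyz; have x_gt0 := quartic_triple_gt0 xyz; case: xyz => y_gt0 z_gt0 xyz.
rewrite /coprime; move: (dvdn_gcdl x y) (dvdn_gcdr x y).
have : 0 < gcdn x y by rewrite gcdn_gt0 x_gt0.
move: (gcdn x y) => g g_gt0 /dvdnP[x' x_eq] /dvdnP[y' y_eq] g_neq1.
have /dvdnP[z' z_eq] : g ^ 2 %| z.
  rewrite -(@dvdn_pexp2r _ _ 2) // -expnM -(@dvdn_addr (y ^ 4)).
    by rewrite -xyz x_eq expnMn dvdn_mull.
  by rewrite y_eq expnMn dvdn_mull.
have x'_gt0 : 0 < x' by move: x_gt0; rewrite x_eq muln_gt0 => /andP[].
have y'_gt0 : 0 < y' by move: y_gt0; rewrite y_eq muln_gt0 => /andP[].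
have z'_gt0 : 0 < z' by move: z_gt0; rewrite z_eq muln_gt0 => /andP[].
exists x', y', z'; split; first by rewrite x_eq ltn_Pmulr // ltn_neqAle eq_sym g_neq1.
split=> //.
apply/eqP; rewrite -(@eqn_pmul2r (g ^ 4)) ?expn_gt0 ?g_gt0 // mulnDl -!expnMn -x_eq -y_eq.
by rewrite xyz z_eq expnMn -expnM.
Qed.

Lemma quartic_triple_coprime x y z : quartic_triple x y z -> coprime x y -> coprime y z.
Proof.
case=> _ _ xyz cxy; have : coprime (y ^ 4) (x ^ 4).
  by rewrite coprimeXl // coprimeXr // coprime_sym.
by rewrite xyz /coprime gcdnDl -/(coprime _ _) coprime_pexpl ?coprime_pexpr.
Qed.

Lemma quartic_triple_odd x y z :
  quartic_triple x y z -> coprime x y -> odd y -> smaller_quartic_triple x.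
Proof.
move=> xyz cxy oy; have x_gt0 := quartic_triple_gt0 xyz.
have cyz := quartic_triple_coprime xyz cxy.
case: xyz => y_gt0 z_gt0; rewrite (expnM x 2 2) (expnM y 2 2) => xyz.
have ez : ~~ odd z.
  by apply/negP => oz; apply: sum_odd_sqr_neq oz (esym xyz); rewrite oddX oy.
have [||m [n [m_eq z_eq x_eq _]]] := @pythagorean_param (y ^ 2) z (x ^ 2) _ _ ez (esym xyz).
- by rewrite coprimeXl.
- by rewrite oddX oy.
have /andP[m_gt0 n_gt0] : (0 < m) && (0 < n).
  by move: z_gt0; rewrite z_eq !muln_gt0.
exists m, n, (x * y); split.
  by rewrite -ltn_sqr x_eq -[ltnLHS]addn0 ltn_add2l expn_gt0 n_gt0.
split; rewrite ?muln_gt0 ?x_gt0 //.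
by rewrite (expnM m 2 2) (expnM n 2 2) expnMn x_eq -m_eq; lia.
Qed.

(* [m] and [n] are the legs of a right triangle of area [w^2]. *)
Lemma square_area_descent m n w x :
    coprime m n -> ~~ odd m -> 0 < m -> 0 < n -> m * n = 2 * w ^ 2 ->
    m ^ 2 + n ^ 2 = x ^ 2 ->
  smaller_quartic_triple x.
Proof.
move=> cmn em m_gt0 n_gt0 area mnx.
have [m1 m_eq] : exists m1, m = 2 * m1 by exists m./2; rewrite mul2n even_halfK.
have cm1n : coprime m1 n by apply: coprime_dvdl cmn; rewrite m_eq dvdn_mull.
have m1n : m1 * n = w ^ 2 by move: area; rewrite m_eq; lia.
have [[s m1_eq] [t n_eq]] := coprime_mul_exp cm1n m1n.
have on : odd n.
  by apply: contraTT cmn => on; rewrite m_eq coprimeMl coprime2n (negPf on).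
have [||||u [v [n_uv m_uv x_uv cuv]]] := @pythagorean_param n m x; rewrite 1?coprime_sym //.
  by rewrite addnC.
have uv : u * v = s ^ 2 by move: m_uv; rewrite m_eq m1_eq; lia.
have [[p u_eq] [q v_eq]] := coprime_mul_exp cuv uv.
have /andP[u_gt0 v_gt0] : (0 < u) && (0 < v) by move: m_gt0; rewrite m_uv !muln_gt0.
exists p, q, t; split.
  have p_gt0 : 0 < p by move: u_gt0; rewrite u_eq sqrn_gt0.
  apply: (@leq_ltn_trans (u ^ 2)); last by rewrite x_uv -[ltnLHS]addn0 ltn_add2l sqrn_gt0.
  by rewrite u_eq -expnM -[leqLHS]expn1 leq_pexp2l.
split; first by move: v_gt0; rewrite v_eq sqrn_gt0.
  by move: n_gt0; rewrite n_eq sqrn_gt0.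
by rewrite (expnM p 2 2) -u_eq -n_uv v_eq n_eq -expnM addnC.
Qed.

Lemma quartic_triple_even x y z :
  quartic_triple x y z -> coprime x y -> ~~ odd y -> smaller_quartic_triple x.
Proof.
move=> xyz cxy ey; have cyz := quartic_triple_coprime xyz cxy.
case: xyz => y_gt0 z_gt0; rewrite (expnM x 2 2) (expnM y 2 2) => xyz.
have oz : odd z.
  apply: contraTT cyz => ez; rewrite /coprime; apply/eqP => gcd1.
  by have := dvdn_gcd 2 y z; rewrite gcd1 !dvdn2 ey ez.
have [|||m [n [_ y_eq x_eq cmn]]] := @pythagorean_param z (y ^ 2) (x ^ 2) _ oz.
- by rewrite coprimeXr // coprime_sym.
- by rewrite oddX /= (negPf ey).
- by rewrite addnC.
have [w y_2w] : exists w, y = 2 * w by exists y./2; rewrite mul2n even_halfK.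
have area : m * n = 2 * w ^ 2 by move: y_eq; rewrite y_2w expnMn; lia.
have /andP[m_gt0 n_gt0] : (0 < m) && (0 < n).
  by rewrite -muln_gt0 area muln_gt0 sqrn_gt0; move: y_gt0; rewrite y_2w muln_gt0.
have [em|om] := boolP (~~ odd m); first exact: square_area_descent area (esym x_eq).
apply: (@square_area_descent n m w); rewrite 1?coprime_sym 1?mulnC 1?addnC //.
by apply/negP => on; have := congr1 odd area; rewrite !oddM (negbNE om) on.
Qed.

Lemma fermat_quartic x y z : 0 < y -> 0 < z -> x ^ 4 <> y ^ 4 + z ^ 2.
Proof.
move=> y_gt0 z_gt0 xyz; have {y_gt0 z_gt0 xyz} : quartic_triple x y z by [].
elim/ltn_ind: x y z => x IH y z xyz.
suff [x' [y' [z' [lt_x' /IH]]]] : smaller_quartic_triple x by apply.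
have [cxy|] := boolP (coprime x y); last exact: quartic_triple_noncoprime xyz.
have [oy|ey] := boolP (odd y); first exact: quartic_triple_odd xyz cxy oy.
exact: quartic_triple_even xyz cxy ey.
Qed.

End Fermat.

Section Radical.
Implicit Types m n : nat.

Lemma rad_gt0 n : 0 < Defs.rad n.
Proof.
rewrite /Defs.rad big_seq; apply: prodn_cond_gt0 => p.
by rewrite mem_primes => /andP[/prime_gt0].
Qed.

Lemma radX n k : 0 < k -> Defs.rad (n ^ k) = Defs.rad n.
Proof. by move=> k_gt0; rewrite /Defs.rad primesX. Qed.

Lemma rad_dvdn n : 0 < n -> Defs.rad n %| n.
Proof.
move=> n_gt0; rewrite /Defs.rad {2}(prod_prime_decomp n_gt0) prime_decompE big_map /=.
rewrite big_seq [X in _ %| X]big_seq; apply: (big_ind2 dvdn) => // [|p].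
  by move=> *; apply: dvdn_mul.
by rewrite -logn_gt0 => /dvdn_exp->.
Qed.

Lemma dvdn_rad m n : 0 < n -> m %| n -> Defs.rad m %| Defs.rad n.
Proof.
move=> n_gt0 mn; apply: uniq_sub_le_big; rewrite ?primes_uniq //.
  by move=> a b; apply: dvdn_mulr.
move=> p; rewrite !mem_primes n_gt0 => /and3P[-> _ pm] /=.
exact: dvdn_trans mn.
Qed.

Lemma rad_leq_of_dvdX m n k : 0 < m -> n %| m ^ k.+1 -> Defs.rad n <= m.
Proof.
move=> m_gt0 nm; have rad_nm : Defs.rad n %| Defs.rad m.
  by rewrite -(radX m (ltn0Sn k)) dvdn_rad ?expn_gt0 ?m_gt0.
exact/dvdn_leq/(dvdn_trans rad_nm)/rad_dvdn.
Qed.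

End Radical.

Section PrimePowers.
Implicit Types D N b c e n p s t : nat.

Lemma pnat_of_size_primes n : 0 < n -> size (primes n) <= 1 ->
  exists2 p, prime p & p.-nat n.
Proof.
move=> n_gt0; case primes_eq: (primes n) => [|p [|//]] _; last first.
  exists p; first by have := mem_primes p n; rewrite primes_eq mem_head => /esym/andP[].
  apply/pnatP => // q q_pr qn; have := mem_primes q n.
  by rewrite q_pr n_gt0 qn primes_eq inE.
exists 2 => //; apply/pnatP => // q q_pr qn.
by have := mem_primes q n; rewrite q_pr n_gt0 qn primes_eq.
Qed.

(* The smaller of the valuations of [s] and [t] is at most that of [s + t]. *)
Lemma pfactor_dvdn_mul_sum p e s t : prime p -> p ^ e %| s * t ->
  (p ^ e %| (s + t) * s) || (p ^ e %| (s + t) * t).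
Proof.
move=> p_pr; have [->|s_gt0] := posnP s; first by rewrite muln0 dvdn0.
have [->|t_gt0] := posnP t; first by rewrite !muln0 dvdn0 orbT.
have st_gt0 : 0 < s + t by rewrite addn_gt0 s_gt0.
have : p ^ minn (logn p s) (logn p t) %| s + t.
  by rewrite dvdn_add // pfactor_dvdn // ?geq_minl ?geq_minr.
rewrite !pfactor_dvdn ?muln_gt0 ?s_gt0 ?t_gt0 ?st_gt0 // !lognM //.
by lia.
Qed.

Lemma cofactors_of_dvdn D N c s t : 0 < D -> coprime c D ->
    s * t = N * D -> s + t = 2 * c -> D %| (s + t) * s ->
  exists u v, u * v = 2 * N /\ u * D + 2 * v = 4 * c.
Proof.
move=> D_gt0 cop prod sum; rewrite sum mulnAC Gauss_dvdl 1?coprime_sym //.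
case/dvdnP=> u s2_eq; exists u, t; split; last by rewrite -s2_eq -mulnDr sum mulnA.
by apply/eqP; rewrite -(eqn_pmul2r D_gt0) mulnAC -s2_eq -!mulnA prod.
Qed.

Lemma sqr_sub_sqr_pfactor p e N b c : prime p -> coprime c (p ^ e) ->
    c ^ 2 = N * p ^ e + b ^ 2 ->
  exists u v, u * v = 2 * N /\ u * p ^ e + 2 * v = 4 * c.
Proof.
move=> p_pr cop c2; have pe_gt0 : 0 < p ^ e by rewrite expn_gt0 prime_gt0.
have le_bc : b <= c by rewrite -leq_sqr c2 leq_addl.
have prod : (c - b) * (c + b) = N * p ^ e by rewrite -subn_sqr c2 addnK.
have sum : (c - b) + (c + b) = 2 * c by lia.
have : p ^ e %| (c - b) * (c + b) by rewrite prod dvdn_mull.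
case/(pfactor_dvdn_mul_sum p_pr)/orP; first exact: cofactors_of_dvdn prod sum.
by rewrite addnC; apply: cofactors_of_dvdn => //; [rewrite mulnC | rewrite addnC].
Qed.

End PrimePowers.

Section Abscissae.
Local Open Scope ring_scope.
Implicit Types (x y r : rat) (N M n : nat).

Lemma numq_denqX r n :
  (numq (r ^+ n) = numq r ^+ n) * (denq (r ^+ n) = denq r ^+ n).
Proof.
have frac_eq : r ^+ n = (numq r ^+ n)%:~R / (denq r ^+ n)%:~R.
  by rewrite -{1}(divq_num_den r) expr_div_n !rmorphXn.
have cop : coprime `|numq r ^+ n| `|denq r ^+ n|.
  by rewrite !abszX coprimeXl // coprimeXr // coprime_num_den.
have den_gt0 : 0 < denq r ^+ n by rewrite exprn_gt0 ?denq_gt0.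
by rewrite frac_eq coprimeq_num // coprimeq_den // gt_eqF // gtr0_sg ?mul1r ?gtr0_norm.
Qed.

Lemma denq1_of_sqr_int r (z : int) : r ^+ 2 = z%:~R -> denq r = 1.
Proof.
move=> r2; have := (numq_denqX r 2).2; rewrite r2 denq_int => /esym/eqP.
rewrite sqrf_eq1 => /orP[/eqP//|/eqP den_neg].
by have := denq_gt0 r; rewrite den_neg.
Qed.

Lemma on_curve_sqr_quartic N r y : r != 0 -> on_curve N (Some (r ^+ 2, y)) ->
  exists b : nat, (`|numq r| ^ 4 = N * `|denq r| ^ 4 + b ^ 2)%N.
Proof.
move=> r_neq0 /eqP onP; pose w := y / r * (denq r)%:~R ^+ 2.
have w2 : w ^+ 2 = (numq r ^+ 4 - N%:R * denq r ^+ 4)%:~R.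
  have -> : w ^+ 2 = (r ^+ 4 - N%:R) * (denq r)%:~R ^+ 4.
    by rewrite /w !exprMn onP; field.
  by rewrite intrB intrM !rmorphXn /= numqE natz; ring.
have num_w2 : numq w ^+ 2 = numq r ^+ 4 - N%:R * denq r ^+ 4.
  by apply: (@intr_inj rat); rewrite -w2 rmorphXn /= numqE (denq1_of_sqr_int w2) mulr1.
exists `|numq w|%N; apply: (can_inj absz_nat).
have even_absz (z : int) k : ~~ odd k -> (`|z| ^ k)%N = z ^+ k :> int.
  by move=> ek; rewrite -abszX abszE ger0_norm // exprn_even_ge0.
by rewrite PoszD PoszM !even_absz // num_w2 natz; ring.
Qed.

Lemma norm_x_leq_of_x_le0 N x y : x <= 0 -> on_curve N (Some (x, y)) -> `|x| <= N%:R.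
Proof.
move=> x_le0 /eqP onP; have [->|x_neq0] := eqVneq x 0; first by rewrite normr0 ler0n.
have x2_le : x ^+ 2 <= N%:R.
  have : 0 <= x * (x ^+ 2 - N%:R) by rewrite mulrBr -exprS (mulrC x) -onP sqr_ge0.
  by rewrite nmulr_rge0 ?subr_le0 // lt_neqAle x_neq0.
rewrite -ler_sqr ?nnegrE // real_normK ?num_real // (le_trans x2_le) //.
by rewrite -natrX ler_nat; case: N {onP x2_le} => // N; rewrite -[leqLHS]expn1 leq_pexp2l.
Qed.

Lemma absz_numq_leq x M : `|x| <= M%:R -> (`|numq x| <= M * `|denq x|)%N.
Proof.
move=> x_le; rewrite -lez_nat PoszM !abszE normr_denq -(ler_int rat) rmorphM /= intr_norm.
by rewrite numqE normrM -intr_norm normr_denq ler_wpM2r ?ler0z ?denq_ge0.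
Qed.

Lemma norm_leq_absz_numq x : `|x| <= `|numq x|%:R.
Proof.
have den_ge1 : 1 <= (denq x)%:~R :> rat by rewrite ler1z -gtz0_ge1 denq_gt0.
rewrite pmulrn abszE intr_norm numqE normrM ler_peMr //.
by rewrite (le_trans den_ge1) ?ler_norm.
Qed.

End Abscissae.

Section Logarithms.
Local Open Scope R_scope.
Implicit Types m n : nat.

Lemma INR_leq m n : (m <= n)%N -> INR m <= INR n.
Proof. by move=> /ssrnat.leP; apply: le_INR. Qed.

Lemma INR_gt0 n : (0 < n)%N -> 0 < INR n.
Proof. by move=> /ssrnat.leP; apply: lt_0_INR. Qed.

Lemma ln_le (x y : R) : 0 < x -> x <= y -> ln x <= ln y.
Proof. by move=> x_gt0 [xy|->]; [apply/Rlt_le/ln_increasing | lra]. Qed.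

Lemma ln_INR_leq m n : (0 < m)%N -> (m <= n)%N -> ln (INR m) <= ln (INR n).
Proof. by move=> m_gt0 mn; apply: ln_le; [apply: INR_gt0 | apply: INR_leq]. Qed.

Lemma ln_INR_ge0 n : (0 < n)%N -> 0 <= ln (INR n).
Proof. by move=> n_gt0; rewrite -ln_1; apply: (@ln_INR_leq 1). Qed.

Lemma ln_INRM m n : (0 < m)%N -> (0 < n)%N -> ln (INR (m * n)%N) = ln (INR m) + ln (INR n).
Proof. by move=> m_gt0 n_gt0; rewrite mult_INR ln_mult //; apply: INR_gt0. Qed.

Lemma Rabs_int_to_R (z : int) : Rabs (int_to_R z) = INR `|z|%N.
Proof.
by case: z => n; rewrite /int_to_R ?Rabs_Ropp Rabs_pos_eq //; apply: pos_INR.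
Qed.

Lemma h_O_le (x y : rat) M : (0 < M)%N -> (`|x| <= M%:R)%ring ->
  h_O (Some (x, y)) <= ln (INR M).
Proof.
move=> M_gt0 /absz_numq_leq num_le.
have den_gt0 : 0 < INR `|denq x|%N by apply: INR_gt0; rewrite absz_gt0 denq_neq0.
have x_le : Rabs (rat_to_R x) <= INR M.
  rewrite /rat_to_R /Rdiv Rabs_mult Rabs_inv !Rabs_int_to_R.
  apply: (Rmult_le_reg_r (INR `|denq x|%N)) => //.
  rewrite Rmult_assoc Rinv_l ?Rmult_1_r -?mult_INR; last lra.
  exact: INR_leq.
apply: Rmax_lub; first exact: ln_INR_ge0.
have [x_gt0|x0] := Rabs_pos (rat_to_R x); first exact: ln_le.
(* Here [ln 0 = 0]. *)
rewrite -x0 /ln; case: Rlt_dec => [/Rlt_irrefl //|_].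
exact: ln_INR_ge0.
Qed.

End Logarithms.

Section ABC.
Local Open Scope R_scope.
Implicit Types (N X Y a b p : nat) (eps kappa : R).

Definition log_abc eps kappa : Prop := forall X Y,
  (0 < X)%N -> (0 < Y)%N -> coprime X Y ->
  ln (INR (X + Y)) <= kappa + (1 + eps) * ln (INR (Defs.rad (X * Y * (X + Y)))).

Lemma ABC_log_abc eps : ABC_conjecture -> 0 < eps ->
  exists2 kappa, 0 <= kappa & log_abc eps kappa.
Proof.
move=> ABC /ABC[K abcK]; pose K1 := Rmax 1 K.
have K1_ge1 : 1 <= K1 by apply: Rmax_l.
exists (ln K1) => [|X Y X_gt0 Y_gt0 copXY]; first by rewrite -ln_1; apply: ln_le; lra.
set m := Defs.rad _; have XY_gt0 : (0 < X + Y)%N by rewrite addn_gt0 X_gt0.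
rewrite -ln_Rpower -ln_mult; [|lra|exact: exp_pos].
apply: ln_le; first exact: INR_gt0.
apply: (Rle_trans _ (K * Rpower (INR m) (1 + eps))); last first.
  by apply: Rmult_le_compat_r (Rmax_r _ _); apply/Rlt_le/exp_pos.
have := abcK X Y (X + Y)%N; rewrite /coprimez /gcdz !absz_nat !eqz_nat => /(_ copXY).
rewrite addnC gcdnDl gcdnC addnC gcdnDl => /(_ copXY copXY (PoszD _ _)).
by apply: Rle_trans; apply: INR_leq; rewrite !leq_max leqnn !orbT.
Qed.

Lemma log_abc_gcd eps kappa X Y : log_abc eps kappa -> 0 <= 1 + eps ->
    (0 < X)%N -> (0 < Y)%N ->
  ln (INR (X + Y)) <= ln (INR (gcdn X Y)) + kappa
    + (1 + eps) * ln (INR (Defs.rad (X * Y * (X + Y)))).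
Proof.
move=> abc eps_ge X_gt0 Y_gt0.
have g_gt0 : (0 < gcdn X Y)%N by rewrite gcdn_gt0 X_gt0.
move: (dvdn_gcdl X Y) (dvdn_gcdr X Y) => /dvdnP[X' X_eq] /dvdnP[Y' Y_eq].
have cop : coprime X' Y'.
  by rewrite /coprime -(eqn_pmul2r g_gt0) muln_gcdl -X_eq -Y_eq mul1n.
move: (gcdn X Y) g_gt0 X_eq Y_eq => g g_gt0 X_eq Y_eq; subst X Y.
move: X_gt0 Y_gt0; rewrite !muln_gt0 g_gt0 !andbT -mulnDl => X_gt0 Y_gt0.
have XY_gt0 : (0 < X' + Y')%N by rewrite addn_gt0 X_gt0.
have rad_le : (Defs.rad (X' * Y' * (X' + Y'))
    <= Defs.rad (X' * g * (Y' * g) * ((X' + Y') * g)))%N.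
  apply/dvdn_leq/dvdn_rad; first exact: rad_gt0.
    by rewrite !muln_gt0 X_gt0 Y_gt0 XY_gt0 g_gt0.
  by rewrite !dvdn_mul ?dvdn_mulr.
have := abc X' Y' X_gt0 Y_gt0 cop.
have := Rmult_le_compat_l _ _ _ eps_ge (ln_INR_leq (rad_gt0 _) rad_le).
by rewrite ln_INRM //; lra.
Qed.

(* The exponent [7/6] is chosen below [4/3]: as [B^2 <= 2 a], the radical is at
   most [2 N B a = O(N a^(3/2))], and its power has to stay below [a^2]. *)
Lemma log_abc_quartic_sum kappa N a B u v : log_abc (1 / 6) kappa -> (1 < N)%N ->
    (0 < a)%N -> (0 < B)%N -> (u * v = 2 * N)%N -> (u * B ^ 4 + 2 * v = 4 * a ^ 2)%N ->
  ln (INR (a ^ 2)) <= 32 * ln (INR N) + 8 * kappa.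
Proof.
move=> abc N_gt1 a_gt0 B_gt0 uv uB; have N_gt0 := ltnW N_gt1.
have /andP[u_gt0 v_gt0] : (0 < u)%N && (0 < v)%N by rewrite -muln_gt0 uv muln_gt0.
have uB_gt0 : (0 < u * B ^ 4)%N by rewrite muln_gt0 u_gt0 expn_gt0 B_gt0.
have v2_gt0 : (0 < 2 * v)%N by rewrite muln_gt0.
have B_le : (B ^ 4 <= 2 ^ 2 * a ^ 2)%N.
  by rewrite -uB (leq_trans _ (leq_addr _ _)) // leq_pmull.
pose g := gcdn (u * B ^ 4) (2 * v).
pose r := Defs.rad (u * B ^ 4 * (2 * v) * (u * B ^ 4 + 2 * v)).
have g_gt0 : (0 < g)%N by rewrite gcdn_gt0 uB_gt0.
have r_gt0 : (0 < r)%N by apply: rad_gt0.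
have g_le : (g <= 2 ^ 2 * N)%N.
  apply: leq_trans (dvdn_leq v2_gt0 (dvdn_gcdr _ _)) _.
  by rewrite -mulnA leq_mul2l -uv leq_pmull.
have r_le : (r <= 2 * N * B * a)%N.
  apply: (@rad_leq_of_dvdX _ _ 3); first by rewrite !muln_gt0 N_gt0 B_gt0.
  apply/dvdnP; exists (N ^ 3 * a ^ 2)%N; rewrite uB.
  have -> : (u * B ^ 4 * (2 * v) * (4 * a ^ 2) = 2 * (u * v) * B ^ 4 * (4 * a ^ 2))%N.
    by ring.
  by rewrite uv; ring.
have : ln (INR (2 ^ 2 * a ^ 2)) <= ln (INR g) + kappa + (1 + 1 / 6) * ln (INR r).
  by rewrite -[(2 ^ 2)%N]/4%N -uB; apply: log_abc_gcd => //; lra.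
move: (ln_INR_leq g_gt0 g_le) (ln_INR_leq r_gt0 r_le).
have := ln_INR_leq (_ : 0 < B ^ 4)%N B_le; rewrite expn_gt0 B_gt0 => /(_ isT).
move: (ln_INR_ge0 N_gt0) (ln_INR_leq (isT : 0 < 2)%N N_gt1).
by rewrite !ln_INRM ?muln_gt0 ?N_gt0 ?B_gt0 ?a_gt0 //; lra.
Qed.

Lemma quartic_log_bound kappa N a b p B : log_abc (1 / 6) kappa -> (1 < N)%N ->
    (0 < a)%N -> prime p -> p.-nat B -> coprime a B ->
    (a ^ 4 = N * B ^ 4 + b ^ 2)%N ->
  ln (INR (a ^ 2)) <= 32 * ln (INR N) + 8 * kappa.
Proof.
move=> abc N_gt1 a_gt0 p_pr B_pnat cop; rewrite (expnM a 2 2).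
have /p_natP[e B4_eq] : p.-nat (B ^ 4)%N by rewrite pnatX B_pnat.
have cop4 : coprime (a ^ 2) (p ^ e) by rewrite -B4_eq coprimeXl ?coprimeXr.
rewrite {1}B4_eq => /(sqr_sub_sqr_pfactor p_pr cop4)[u [v [uv]]]; rewrite -B4_eq => uB.
by apply: log_abc_quartic_sum uv uB => //; case/andP: B_pnat.
Qed.

End ABC.

Section HeightBound.
Local Open Scope R_scope.
Implicit Types (N : nat) (P : point).

Lemma h_O_square_point_one (r y : rat) : (r != 0)%ring ->
  on_curve 1 (Some (r ^+ 2, y)%ring) -> h_O (Some (r ^+ 2, y)%ring) <= 0.
Proof.
move=> r_neq0 /(on_curve_sqr_quartic r_neq0)[b]; rewrite mul1n => ab.
have [b_eq0|b_gt0] := posnP b; last first.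
  by case: (fermat_quartic _ b_gt0 ab); rewrite absz_gt0 denq_neq0.
have num_eq : `|numq r|%N = `|denq r|%N.
  by apply/eqP; rewrite -(@eqn_exp2r _ _ 4) // ab b_eq0 addn0.
have := coprime_num_den r; rewrite num_eq /coprime gcdnn => /eqP den1.
rewrite -ln_1; apply: (@h_O_le _ _ 1) => //.
apply: le_trans (norm_leq_absz_numq _) _.
by rewrite numq_denqX abszX num_eq den1.
Qed.

Lemma h_O_square_point kappa N (r y : rat) : log_abc (1 / 6) kappa -> (1 < N)%N ->
    (r != 0)%ring -> on_curve N (Some (r ^+ 2, y)%ring) ->
    (length_L (Some (r ^+ 2, y)%ring) <= 1)%N ->
  h_O (Some (r ^+ 2, y)%ring) <= 32 * ln (INR N) + 8 * kappa.
Proof.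
move=> abc N_gt1 r_neq0 /(on_curve_sqr_quartic r_neq0)[b ab].
rewrite /length_L numq_denqX abszX primesX // => len.
have den_gt0 : (0 < `|denq r|)%N by rewrite absz_gt0 denq_neq0.
have num_gt0 : (0 < `|numq r|)%N by rewrite absz_gt0 numq_eq0.
have [p p_pr den_pnat] := pnat_of_size_primes den_gt0 len.
apply: Rle_trans (quartic_log_bound abc N_gt1 num_gt0 p_pr den_pnat (coprime_num_den r) ab).
apply: h_O_le; first by rewrite expn_gt0 num_gt0.
by apply: le_trans (norm_leq_absz_numq _) _; rewrite numq_denqX abszX.
Qed.

Lemma h_O_bound kappa N P : 0 <= kappa -> log_abc (1 / 6) kappa -> (0 < N)%N ->
    on_curve N P -> negative_or_square (point_class N P) -> (length_L P <= 1)%N ->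
  h_O P <= (32 + 8 * (kappa / ln 2)) * ln (INR N).
Proof.
move=> kappa_ge0 abc N_gt0; have lnN := ln_INR_ge0 N_gt0.
have ln2_gt0 : 0 < ln 2 by have := ln_lt_2; lra.
have kappa_div_ge0 : 0 <= kappa / ln 2 := Rle_mult_inv_pos _ _ kappa_ge0 ln2_gt0.
case: P => [[x y]|] onP; last by move=> _ _; apply: Rmult_le_pos; lra.
case=> [/x_le0_of_point_class_lt0 x_le0 _|].
  apply: Rle_trans (h_O_le y N_gt0 (norm_x_leq_of_x_le0 x_le0 onP)) _.
  by rewrite -[X in X <= _]Rmult_1_l; apply: Rmult_le_compat_r => //; lra.
case/(x_sqr_of_point_class_sqr N_gt0)=> r r_neq0 x_eq len.
subst x; have [N_le1|N_gt1] := leqP N 1.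
  have N_eq1 : N = 1%N by apply/eqP; rewrite eqn_leq N_le1.
  by subst N; rewrite /= ln_1 Rmult_0_r; apply: h_O_square_point_one onP.
apply: Rle_trans (h_O_square_point abc N_gt1 r_neq0 onP len) _.
have ln2_le := ln_INR_leq (isT : 0 < 2)%N N_gt1.
have kappa_eq : kappa = kappa / ln 2 * ln 2 by rewrite /Rdiv Rmult_assoc Rinv_l; lra.
have := Rmult_le_compat_l _ _ _ kappa_div_ge0 ln2_le; rewrite -kappa_eq.
by lra.
Qed.

End HeightBound.

Theorem theorem1p2 :
  ABC_conjecture ->
  exists c : R, (0 < c)%R /\
  forall (N : nat), (0 < N)%N ->
  forall Q1 : point,
    on_curve N Q1 ->
    (forall n : int, n <> Posz 0 -> ec_mul N n Q1 <> None) ->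
    x_neg Q1 ->
    (* (1) *)
    (forall n : int, n <> Posz 0 -> (length_L (ec_mul N n Q1) <= 1)%N ->
        (h_O (ec_mul N n Q1) <= c * ln (INR N))%R) /\
    (* (2) *)
    (forall Q2 : point,
        on_curve N Q2 ->
        (forall a b : int,
            ec_add N (ec_mul N a Q1) (ec_mul N b Q2) = None ->
            a = Posz 0 /\ b = Posz 0) ->
        ((exists R0 : point, on_curve N R0 /\ Q2 = ec_add N R0 R0)
         \/ x_is_square Q2) ->
        forall Q : point,
          (exists n1 n2 : int, Q = ec_add N (ec_mul N n1 Q1) (ec_mul N n2 Q2)) ->
          Q <> None ->
          (length_L Q <= 1)%N ->
          (h_O Q <= c * ln (INR N))%R).
Proof.
move=> ABC; have [|kappa kappa_ge0 abc] := @ABC_log_abc (1 / 6) ABC; first lra.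
exists (32 + 8 * (kappa / ln 2))%R; split.
  have ln2_gt0 : (0 < ln 2)%R by have := ln_lt_2; lra.
  by have := Rle_mult_inv_pos _ _ kappa_ge0 ln2_gt0; rewrite /Rdiv; lra.
move=> N N_gt0 Q1 on1 _ /(@point_class_lt0 N) neg1.
split=> [n _|Q2 on2 indep double_or_square Q [n1 [n2 ->]] _].
  apply: h_O_bound => //; first exact: on_curve_mul.
  apply: negative_or_square_eq_mod_sqr (negative_or_squareX `|n| neg1).
  exact: point_class_mul.
have class2 : eq_mod_sqr (point_class N Q2) 1.
  case: double_or_square => [[P [onP ->]]|]; first exact: point_class_double.
  by apply: point_class_x_square => // Q2_2; have [] := indep 0 2; rewrite //= Q2_2.
apply: h_O_bound => //; first by apply: on_curve_add; apply: on_curve_mul.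
apply: negative_or_square_eq_mod_sqr (negative_or_squareX `|n1| neg1).
exact: point_class_lincomb.
Qed.
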